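(* Assume that there exist a probability measure $\alpha$ on $E$ and constants $C,\gamma>0$ such that $$\left\|\mathbb{P}_\mu(X_t\in\cdot\mid t<\tau_\partial)-\alpha\right\|_{TV}\leq C e^{-\gamma t},\qquad\forall \mu\in\mathcal{P}(E),\ \forall t\geq 0.$$ Let $\lambda_0>0$, $\eta:E\to(0,\infty)$ and $(\mathbb{Q}_x)_{x\in E}$ be the associated constant, function and $Q$-process (defined in the context). Then: (1) there exists a positive constant $a_1$ such that, for all $x\in E$ and all $t\geq 0$, $$\left|e^{\lambda_0 t}\,\mathbb{P}_x(t<\tau_\partial)-\eta(x)\right|\leq a_1\, e^{\lambda_0 t}\,\mathbb{P}_x(t<\tau_\partial)\,e^{-\gamma t};$$ (2) there exists a positive constant $a_2$ such that, for all $x\in E$, all $t\geq 0$, all $\Gamma\in\mathcal{F}_t$ and all $T\geq t$, $$\left|\mathbb{Q}_x(\Gamma)-\mathbb{P}_x(\Gamma\mid T<\tau_\partial)\right|\leq a_2\, e^{-\gamma (T-t)}.$$ Here $\gamma$ is the same constant as in the assumption.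
   Context: Setting. $(\Omega,(\mathcal{F}_t)_{t\geq 0},(X_t)_{t\geq 0},(\mathbb{P}_x)_{x\in E\cup\{\partial\}})$ is a time-homogeneous Markov process with state space $E\cup\{\partial\}$, where $E$ is a measurable space and $\partial\notin E$. The point $\partial$ is absorbing: $X_s=\partial$ implies $X_t=\partial$ for all $t\geq s$, $\mathbb{P}_x$-almost surely for all $x\in E$. Set $\tau_\partial:=\inf\{t\geq 0: X_t=\partial\}$, which is a stopping time. It is assumed that $\mathbb{P}_x(\tau_\partial<\infty)=1$ and $\mathbb{P}_x(t<\tau_\partial)>0$ for all $t\geq 0$ and all $x\in E$. $\mathbb{E}_x$ is the expectation under $\mathbb{P}_x$. $\mathcal{P}(E)$ is the set of probability measures on $E$; for $\mu\in\mathcal{P}(E)$, $\mathbb{P}_\mu=\int_E\mathbb{P}_x\,\mu(dx)$ is the law of the process with initial distribution $\mu$. $\|\cdot\|_{TV}$ is the total variation norm. Objects associated with the assumption. Under the assumption of the claim (uniform exponential convergence to $\alpha$), the following facts are known from earlier work. The measure $\alpha$ is the unique quasi-stationary distribution of $X$, i.e. the unique probability measure on $E$ with $\mathbb{P}_\alpha(X_t\in\cdot\mid t<\tau_\partial)=\alpha$ for all $t\ge0$. There is a constant $\lambda_0>0$ such that $\mathbb{P}_\alpha(t<\tau_\partial)=e^{-\lambda_0 t}$ for all $t\ge 0$, and there is a function $\eta:E\to(0,\infty)$ with $\int_E\eta\,d\alpha=1$ such that $$\lim_{t\to+\infty}\sup_{x\in E}\left|e^{\lambda_0 t}\mathbb{P}_x(t<\tau_\partial)-\eta(x)\right|=0.$$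 The $Q$-process (the process $X$ conditioned never to be absorbed) is the family $(\mathbb{Q}_x)_{x\in E}$ of probability measures on $\Omega$ defined by $$\mathbb{Q}_x(\Gamma)=\lim_{t\to+\infty}\mathbb{P}_x(\Gamma\mid t<\tau_\partial),\qquad \forall\,\Gamma\in\mathcal{F}_s,\ \forall s\geq 0;$$ it is well defined, and under $(\mathbb{Q}_x)_{x\in E}$ the process $X$ is an $E$-valued homogeneous Markov process. *)

(* Defs.v *)
From HB Require Import structures.
From mathcomp Require Import all_boot all_order all_algebra.
From mathcomp Require Import all_classical all_reals all_analysis.
From mathcomp Require Import measurable_realfun.

Set Implicit Arguments.
Unset Strict Implicit.
Unset Printing Implicit Defensive.

Import Order.TTheory GRing.Theory Num.Theory.
Import numFieldNormedType.Exports.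

Local Open Scope classical_set_scope.
Local Open Scope ring_scope.

(* The state space E U {cemetery} is [option E], with [None] the cemetery; its
   sigma-algebra is generated by the measurable sets of E and {cemetery}. *)
Section option_measurable.
Context (d : measure_display) (E : measurableType d).

Definition option_measurable : set (set (option E)) :=
  [set B | measurable (Some @^-1` B)].

Lemma option_measurable0 : option_measurable set0.
Proof. by rewrite /option_measurable /= preimage_set0. Qed.

Lemma option_measurableC (B : set (option E)) :
  option_measurable B -> option_measurable (~` B).
Proof.
by rewrite /option_measurable /= => mB; rewrite preimage_setC; exact: measurableC.
Qed.

Lemma option_measurable_bigcup (B : (set (option E))^nat) :
  (forall i, option_measurable (B i)) -> option_measurable (\bigcup_i B i).
Proof.
rewrite /option_measurable /= => mB; rewrite preimage_bigcup.
exact: bigcupT_measurable.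
Qed.

Definition option_display : measure_display -> measure_display.
Proof. exact. Qed.

HB.instance Definition _ := @isMeasurable.Build (option_display d) (option E)
  option_measurable option_measurable0 option_measurableC
  option_measurable_bigcup.

End option_measurable.

(* Continuous-time families are indexed by all of R; only the times t >= 0 are
   ever used. *)
Section absorbed_process.
Context (R : realType) (dO dE : measure_display)
  (Omega : measurableType dO) (E : measurableType dE).

Record filtration (F : R -> set (set Omega)) : Prop := Filtration {
  filtration_sigma_algebra : forall t, 0 <= t -> sigma_algebra setT (F t) ;
  filtration_sub : forall t, 0 <= t -> F t `<=` measurable ;
  filtration_homo : forall s t, 0 <= s -> s <= t -> F s `<=` F t }.

Definition F_infty (F : R -> set (set Omega)) : set (set Omega) :=
  \bigcup_(t in [set t | 0 <= t]) F t.

(* The initial law is stated with a Dirac mass because {x} need not be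
   measurable. [markov_property] is the defining identity of the conditional
   probability: P_x(X_{s+t} \in B | F_s) = P_{X_s}(X_t \in B), P_x-a.s. *)
Record markov_process (F : R -> set (set Omega)) (X : R -> Omega -> option E)
    (P : option E -> probability Omega R) : Prop := MarkovProcess {
  markov_filtration : filtration F ;
  markov_adapted : forall (t : R) (B : set (option E)),
    0 <= t -> measurable B -> F t (X t @^-1` B) ;
  markov_initial : forall (x : option E) (B : set (option E)),
    measurable B -> P x (X 0 @^-1` B) = \d_x B ;
  markov_kernel : forall (t : R) (B : set (option E)),
    0 <= t -> measurable B ->
    measurable_fun setT (fun x => P x (X t @^-1` B)) ;
  markov_property : forall (x : option E) (s t : R) (A : set Omega)
      (B : set (option E)),
    0 <= s -> 0 <= t -> F s A -> measurable B ->
    P x (A `&` X (s + t) @^-1` B) =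
    (\int[P x]_(w in A) P (X s w) (X t @^-1` B))%E }.

Definition tau_abs (X : R -> Omega -> option E) (w : Omega) : \bar R :=
  ereal_inf (EFin @` [set t | 0 <= t /\ X t w = None]).

Definition alive (X : R -> Omega -> option E) (t : R) : set Omega :=
  [set w | (t%:E < tau_abs X w)%E].

Record absorbed_markov_process (F : R -> set (set Omega))
    (X : R -> Omega -> option E)
    (P : option E -> probability Omega R) : Prop := AbsorbedMarkovProcess {
  absorbed_markov : markov_process F X P ;
  absorbed_absorbing : forall x : E, {ae P (Some x), forall w : Omega,
    forall s t : R, 0 <= s -> s <= t -> X s w = None -> X t w = None} ;
  absorbed_stopping : forall t : R, 0 <= t ->
    F t [set w | (tau_abs X w <= t%:E)%E] ;
  absorbed_finite : forall x : E,
    P (Some x) [set w | (tau_abs X w < +oo)%E] = 1%E ;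
  absorbed_alive : forall (x : E) (t : R), 0 <= t ->
    (0 < P (Some x) (alive X t))%E }.

Definition P_init (P : option E -> probability Omega R) (mu : probability E R)
    (A : set Omega) : \bar R :=
  (\int[mu]_x P (Some x) A)%E.

Definition cond_prob (p : set Omega -> \bar R) (A B : set Omega) : R :=
  fine (p (A `&` B)) / fine (p B).

Definition cond_law (X : R -> Omega -> option E)
    (P : option E -> probability Omega R) (mu : probability E R) (t : R)
    (B : set E) : R :=
  cond_prob (P_init P mu) (X t @^-1` (Some @` B)) (alive X t).

Definition is_Q_process (F : R -> set (set Omega)) (X : R -> Omega -> option E)
    (P : option E -> probability Omega R)
    (Q : E -> probability (g_sigma_algebraType (F_infty F)) R) : Prop :=
  forall (x : E) (s : R) (A : set Omega), 0 <= s -> F s A ->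
    cond_prob (P (Some x)) A (alive X t) @[t --> +oo] --> fine (Q x A).

End absorbed_process.

(* The total mass of the variation of nu: the supremum of
   \sum_i |nu (A i)| over the finite measurable partitions of T. *)
Definition tv_norm (R : realType) (d : measure_display) (T : measurableType d)
    (nu : set T -> R) : \bar R :=
  ereal_sup [set y | exists (n : nat) (A : 'I_n -> set T),
    [/\ forall i, measurable (A i), trivIset setT A, \bigcup_i A i = setT &
        y = (\sum_(i < n) `|nu (A i)|)%:E]].

(* Main.v *)
Require Import Defs.
From HB Require Import structures.
From mathcomp Require Import all_boot all_order all_algebra.
From mathcomp Require Import all_classical all_reals all_analysis.
From mathcomp Require Import measurable_realfun.
From mathcomp Require Import ring lra.

(** Write S_t(x) for P_x(t < tau) and lambda for lambda0.  By the Markov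
    property at time s, S_(s+r)(x) is S_s(x) times the integral of S_r against
    the law of X_s conditioned on survival.  That law is within
    C exp(- gamma s) of alpha in total variation, alpha integrates S_r to
    exp(- lambda r), and the uniform convergence to eta bounds exp(lambda r) S_r
    by a constant M (for large r it is close to eta, which is itself close to
    exp(lambda t0) S_t0 for some t0 and hence bounded; for small r, S_r <= 1).
    So
    [| exp(lambda r) S_(s+r) - S_s | <= M C exp(- gamma s) S_s]
    pointwise, uniformly in r ([cond_survival_tv]).

    Both claims follow from this relative estimate.  Multiplied by
    exp(lambda s), it gives the first one as r tends to infinity.  For the
    second one, it is integrated against the law of X_t on an event A of F_t
    ([restricted_survival_compare]): the same bound, with s = T - t, compares
    exp(lambda r) P_x(A, T + r < tau) with P_x(A, T < tau).  Applied to A and to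
    the whole space, this shows that the numerator and the denominator of
    P_x(A | T + r < tau) both have, up to the common factor exp(- lambda r), a
    small relative variation in r; hence so has the ratio ([ratio_distance]),
    and it converges to Q_x(A) as r tends to infinity.

    The delicate part is the Markov property for the event that the path is
    still alive: without regularity of the paths, t < tau is not the event
    X_t in E, but almost surely the increasing union of the events
    X_(t + 1/n) in E ([presence_cvg]).  The Markov property is therefore proved
    first for the latter ([markov_presence]) and passed to the limit by monotone
    convergence ([markov_survival]). *)

Import Order.TTheory GRing.Theory Num.Theory.
Import numFieldNormedType.Exports.

Local Open Scope classical_set_scope.
Local Open Scope ring_scope.

(** * Integration and total variation *)

Section total_variation.
Set Implicit Arguments.
Unset Strict Implicit.
Unset Printing Implicit Defensive.
Context (R : realType) (d : measure_display) (T : measurableType d).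
Implicit Types (nu : set T -> R) (m : {measure set T -> \bar R}) (e M : R).

Lemma tv_norm_ub nu e (n : nat) (A : 'I_n -> set T) :
  (tv_norm nu <= e%:E)%E -> (forall i, measurable (A i)) -> trivIset setT A ->
  \bigcup_i A i = setT -> \sum_(i < n) `|nu (A i)| <= e.
Proof.
move=> nue mA tA UA; rewrite -lee_fin; apply: le_trans nue.
by apply: ereal_sup_ubound; exists n, A.
Qed.

(** The norm only sees measurable sets and absolute values, so it can be
    transported both along an equality of set functions and along a change of
    sign. *)
Lemma eq_tv_norm nu1 nu2 :
  (forall A, measurable A -> `|nu1 A| = `|nu2 A|) -> tv_norm nu1 = tv_norm nu2.
Proof.
move=> nu12; congr ereal_sup.
by apply/seteqP; split=> y [n [A [mA tA UA ->]]]; exists n, A; split=> //;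
  congr EFin; apply: eq_bigr => i _; rewrite nu12.
Qed.

Import HBNNSimple.

(** The level sets of a simple function form a finite measurable partition, on
    which the definition of the total variation norm applies directly. *)
Lemma sintegral_le_tv m1 m2 e M (h : {nnsfun T >-> R}) :
  (forall A, measurable A -> m1 A \is a fin_num) ->
  (forall A, measurable A -> m2 A \is a fin_num) ->
  (tv_norm (fun A => (fine (m1 A) - fine (m2 A))%R) <= e%:E)%E ->
  0 <= M -> (forall x, h x <= M) ->
  (sintegral m1 h <= sintegral m2 h + (M * e)%:E)%E.
Proof.
move=> fin1 fin2 tv M0 hM.
rewrite !sintegralE !fsbig_finite//=.
set r : seq R := finmap.enum_fset (fset_set (range h)).
have ur : uniq r by exact: finmap.fset_uniq.
have memr y : (y \in r) = (y \in range h) by rewrite /r in_fset_set.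
have mh y : measurable (h @^-1` [set y]) by [].
rewrite (big_nth 0) [in leRHS](big_nth 0) !big_mkord.
pose A (i : 'I_(size r)) := h @^-1` [set r`_i].
have mA i : measurable (A i) by exact: mh.
have tA : trivIset setT A.
  move=> i j _ _ [x [/= hi hj]]; apply/val_inj/eqP.
  by rewrite -(nth_uniq 0 (ltn_ord i) (ltn_ord j) ur) -hi -hj.
have UA : \bigcup_i A i = setT.
  apply/seteqP; split=> // x _.
  have hx : h x \in r by rewrite memr; apply/mem_set; exists x.
  have ix : (index (h x) r < size r)%N by rewrite index_mem.
  by exists (Ordinal ix) => //=; rewrite /A /= nth_index.
have {tv}tvA := tv_norm_ub tv mA tA UA.
have eqE m : (forall A, measurable A -> m A \is a fin_num) ->
    (\sum_(i < size r) (r`_i)%:E * m (h @^-1` [set r`_i]))%E =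
    (\sum_(i < size r) r`_i * fine (m (A i)))%:E.
  move=> fin; rewrite -sumEFin; apply: eq_bigr => i _.
  by rewrite EFinM fineK// fin.
rewrite (eqE _ fin1) (eqE _ fin2) -EFinD lee_fin -lerBlDl -sumrB.
apply: le_trans (ler_wpM2l M0 tvA); rewrite mulr_sumr; apply: ler_sum => i _.
have /[!inE] -[x _ hx] : r`_i \in range h by rewrite -memr mem_nth.
rewrite -mulrBr (le_trans (ler_norm _))// normrM.
by rewrite ler_wpM2r// ger0_norm -hx.
Qed.

(** Since the integral of f is the supremum of the integrals of the simple
    functions below f, the bound for simple functions passes to f with no
    limiting argument. *)
Lemma le_integral_tv m1 m2 e M (f : T -> \bar R) :
  (forall A, measurable A -> m1 A \is a fin_num) ->
  (forall A, measurable A -> m2 A \is a fin_num) ->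
  (tv_norm (fun A => (fine (m1 A) - fine (m2 A))%R) <= e%:E)%E ->
  0 <= M -> (forall x, 0 <= f x)%E -> (forall x, f x <= M%:E)%E ->
  (\int[m1]_x f x <= \int[m2]_x f x + (M * e)%:E)%E.
Proof.
move=> fin1 fin2 tv M0 f0 fM.
rewrite !ge0_integralTE//; apply: ge_ereal_sup => _ [h /= hf <-].
apply: le_trans (sintegral_le_tv fin1 fin2 tv M0 _) _.
  by move=> x; rewrite -lee_fin (le_trans (hf x)).
by rewrite leeD2r//; apply: ereal_sup_ubound; exists h.
Qed.

Lemma integral_mrestr (mu : {measure set T -> \bar R}) (D : set T)
    (mD : measurable D) (f : T -> \bar R) :
  measurable_fun setT f -> (forall w, (0 <= f w)%E) ->
  (\int[mrestr mu mD]_w f w = \int[mu]_(w in D) f w)%E.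
Proof.
move=> mf f0; rewrite [LHS](ge0_negligible_integral (measurableC mD))//;
  last first.
  by rewrite /= /mrestr setICl measure0.
rewrite setTD setCK; apply: eq_measure_integral => B mB BD.
by rewrite /= /mrestr setIidl.
Qed.

End total_variation.

(** * Measurability on the state space with cemetery *)

Section option_measurability.
Set Implicit Arguments.
Unset Strict Implicit.
Unset Printing Implicit Defensive.
Context (d d' : measure_display) (E : measurableType d)
  (Y : measurableType d').

Lemma measurable_Some : measurable_fun setT (@Some E).
Proof. by move=> _ B mB; rewrite setTI. Qed.

Lemma measurable_fun_option (f : option E -> Y) :
  measurable_fun setT (f \o Some) -> measurable_fun setT f.
Proof. by move=> mf _ B mB; have := mf measurableT B mB; rewrite !setTI. Qed.

Lemma measurable_image_Some (B : set E) :
  measurable B -> measurable (Some @` B).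
Proof.
rewrite -[measurable (Some @` B)]/(measurable (Some @^-1` (Some @` B))).
rewrite (_ : Some @^-1` (Some @` B) = B)//.
by apply/seteqP; split=> x => [[_ ? [<-]]//|Bx]; exists x.
Qed.

Lemma measurable_range_Some : measurable (range (@Some E)).
Proof. exact: measurable_image_Some measurableT. Qed.

End option_measurability.

(** * Survival of an absorbed Markov process *)

Section absorbed_process_survival.
Set Implicit Arguments.
Unset Strict Implicit.
Unset Printing Implicit Defensive.
Context (R : realType) (dO dE : measure_display)
  (Omega : measurableType dO) (E : measurableType dE)
  (F : R -> set (set Omega)) (X : R -> Omega -> option E)
  (P : option E -> probability Omega R) (hX : absorbed_markov_process F X P).
Implicit Types (x : E) (s t u : R) (A : set Omega).

Local Notation in_E t := (X t @^-1` range Some).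

Definition survival t x : \bar R := P (Some x) (alive X t).

(** This is at least [survival t x], and the two differ when the event that
    tau = t while X_t is in E has positive probability. *)
Definition presence t x : \bar R := P (Some x) (in_E t).

(** The value at the cemetery is forced to be 0, instead of P_None(t < tau) for
    a survival function: absorption is almost sure from the points of E only,
    so the latter probability need not be 0. *)
Definition extend0 (f : E -> \bar R) (z : option E) : \bar R :=
  if z is Some x then f x else 0%E.

Let hM := absorbed_markov hX.
Let hF := markov_filtration hM.

Lemma F_measurable t A : 0 <= t -> F t A -> measurable A.
Proof. by move=> t0; exact: filtration_sub hF _ t0 _. Qed.

Lemma F_setI t A B : 0 <= t -> F t A -> F t B -> F t (A `&` B).
Proof.
move=> t0 FA FB; have [_ FC FU] := filtration_sigma_algebra hF t0.
have -> : A `&` B = setT `\` (\bigcup_n (if n == 0%N then setT `\` A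
                                         else setT `\` B)).
  rewrite -[LHS]setCK setCI setTD; congr (~` _); apply/seteqP; split=> w.
    by case=> ?; [exists 0%N|exists 1%N].
  by case=> -[|n] _ [_ ?]; [left|right].
by apply: (FC); apply: FU => -[|n] /=; exact: FC.
Qed.

Lemma F_alive t : 0 <= t -> F t (alive X t).
Proof.
move=> t0; have [_ FC _] := filtration_sigma_algebra hF t0.
suff -> : alive X t = setT `\` [set w | (tau_abs X w <= t%:E)%E].
  exact/FC/(absorbed_stopping hX t0).
rewrite setTD; apply/seteqP; split=> w; rewrite /alive /= ltNge.
  by move/negP.
by move=> ?; apply/negP.
Qed.

Lemma F_setT t : 0 <= t -> F t setT.
Proof.
move=> t0; have [F0 FC _] := filtration_sigma_algebra hF t0.
by rewrite -(setD0 setT); exact: FC.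
Qed.

Lemma measurable_X t : 0 <= t -> measurable_fun setT (X t).
Proof.
move=> t0 _ B mB; rewrite setTI; apply: (F_measurable t0).
exact: markov_adapted hM _ _ t0 mB.
Qed.

Lemma measurable_alive t : 0 <= t -> measurable (alive X t).
Proof. by move=> t0; exact: F_measurable (F_alive t0). Qed.

Lemma measurable_in_E t : 0 <= t -> measurable (in_E t).
Proof.
by move=> t0; rewrite -[in_E t]setTI; apply: measurable_X => //;
  exact: measurable_range_Some.
Qed.

(** If the path is in E at a time t + 1/n then absorption forbids any earlier
    visit to the cemetery, so tau >= t + 1/n > t; if it is at the cemetery at
    all these times, then tau is at most each of them, hence at most t. *)
Lemma aliveP t w : 0 <= t ->
  (forall s u, 0 <= s -> s <= u -> X s w = None -> X u w = None) ->
  alive X t w <-> exists n : nat, in_E (t + n.+1%:R^-1) w.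
Proof.
move=> t0 absw; split=> [tw|[n [x _ Xx]]].
  apply: contrapT => /forallNP noE.
  have : (tau_abs X w <= t%:E)%E.
    apply/lee_addgt0Pr => e e0.
    have [n _ ne] := near_infty_natSinv_lt (PosNum e0).
    have /= {}ne := ne n (leqnn n).
    apply: (@le_trans _ _ (t + n.+1%:R^-1)%:E); last first.
      by rewrite -EFinD lee_fin lerD2l ltW.
    apply: ereal_inf_lbound; exists (t + n.+1%:R^-1) => //; split.
      by rewrite addr_ge0.
    by case Xw : (X _ w) => [y|//]; case: (noE n); exists y.
  by rewrite leNgt => /negP; apply.
rewrite /alive /=; apply: (@lt_le_trans _ _ (t + n.+1%:R^-1)%:E).
  by rewrite lte_fin ltrDl invr_gt0.
apply: le_ereal_inf_tmp => _ [s [s0 Xs] <-]; rewrite lee_fin leNgt.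
apply/negP => /ltW sn; move: Xx.
by rewrite (absw _ _ s0 sn Xs).
Qed.

Lemma presence_nonincreasing x s u : 0 <= s -> s <= u ->
  (presence u x <= presence s x)%E.
Proof.
move=> s0 su; have [N [mN N0 subN]] := absorbed_absorbing hX x.
have u0 := le_trans s0 su.
have sub : in_E u `<=` in_E s `|` N.
  move=> w [y _ Xy]; have [Nw|Nw] := pselect (N w); [by right|left].
  case Xs : (X s w) => [z|]; first by exists z.
  exfalso; apply: Nw; apply: subN => /= /(_ s u s0 su Xs).
  by rewrite -Xy.
rewrite /presence -(measureU0 (measurable_in_E s0) mN N0).
apply: le_measure sub; rewrite inE; first exact: measurable_in_E.
by apply: measurableU => //; exact: measurable_in_E.
Qed.

(** Off the null set where absorption fails, the events on the left increase
    to the one on the right. *)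
Lemma presence_cvg x t A : 0 <= t -> measurable A ->
  P (Some x) (A `&` in_E (t + n.+1%:R^-1)) @[n --> \oo] -->
    P (Some x) (A `&` alive X t).
Proof.
move=> t0 mA; have [N [mN N0 subN]] := absorbed_absorbing hX x.
have absN w : ~ N w -> forall s u, 0 <= s -> s <= u ->
    X s w = None -> X u w = None.
  by move=> Nw; apply: contrapT => nabs; exact/Nw/subN.
have tn0 n : 0 <= t + n.+1%:R^-1 by rewrite addr_ge0.
have PDN B : measurable B -> P (Some x) (B `\` N) = P (Some x) B.
  move=> mB; have mBN := measurableD mB mN.
  apply/eqP; rewrite eq_le; apply/andP; split.
    by apply: le_measure; rewrite ?inE//; exact: subDsetl.
  rewrite -(measureU0 mBN mN N0); apply: le_measure; rewrite ?inE//.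
    exact: measurableU.
  by move=> w Bw; have [Nw|Nw] := pselect (N w); [right|left].
have mB n : measurable (A `&` in_E (t + n.+1%:R^-1)).
  by apply: measurableI => //; exact: measurable_in_E.
have mC : measurable (A `&` alive X t).
  by apply: measurableI => //; exact: measurable_alive.
rewrite -(PDN _ mC).
under eq_fun do rewrite -(PDN _ (mB _)).
have -> : (A `&` alive X t) `\` N =
    \bigcup_n ((A `&` in_E (t + n.+1%:R^-1)) `\` N).
  apply/seteqP; split=> w.
    case=> -[Aw /(aliveP t0 (absN _ _)) tw] Nw.
    by have [n ?] := tw Nw; exists n.
  case=> n _ [[Aw nw] Nw]; split=> //; split=> //.
  by apply/(aliveP t0 (absN _ Nw)); exists n.
apply: nondecreasing_cvg_mu => [n||n m nm].
- exact: measurableD.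
- by apply: bigcupT_measurable => n; exact: measurableD.
- apply/subsetPset => w [[Aw [y _ Xy]] Nw]; split=> //; split=> //.
  case Xs : (X (t + m.+1%:R^-1) w) => [z|]; first by exists z.
  have := absN _ Nw _ _ (tn0 m) _ Xs => /(_ (t + n.+1%:R^-1)).
  by rewrite -Xy lerD2l lef_pV2 ?posrE// ler_nat ltnS => /(_ nm).
Qed.

Lemma survival_cvg x t : 0 <= t ->
  presence (t + n.+1%:R^-1) x @[n --> \oo] --> survival t x.
Proof.
by move=> t0; have := presence_cvg (x := x) t0 measurableT; rewrite setTI;
  under eq_fun do rewrite setTI.
Qed.

Lemma survival_ge0 t x : (0 <= survival t x)%E. Proof. exact: measure_ge0. Qed.

Lemma survival_le1 t x : 0 <= t -> (survival t x <= 1)%E.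
Proof. by move=> t0; apply: probability_le1; exact: measurable_alive. Qed.

Lemma survival_fin_num t x : 0 <= t -> survival t x \is a fin_num.
Proof. by move=> t0; apply: fin_num_measure; exact: measurable_alive. Qed.

Lemma measurable_presence t : 0 <= t -> measurable_fun setT (presence t).
Proof.
move=> t0; have mk := markov_kernel hM t0 (@measurable_range_Some _ E).
exact: measurableT_comp mk (@measurable_Some _ E).
Qed.

Lemma measurable_survival t : 0 <= t -> measurable_fun setT (survival t).
Proof.
move=> t0; apply: (emeasurable_fun_cvg (fun n => presence (t + n.+1%:R^-1))).
  by move=> n; apply: measurable_presence; rewrite addr_ge0.
by move=> x _; exact: survival_cvg.
Qed.

Lemma measurable_extend0 f :
  measurable_fun setT f -> measurable_fun setT (extend0 f).
Proof. by move=> mf; exact: measurable_fun_option. Qed.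

Lemma extend0_ge0 f z : (forall x, (0 <= f x)%E) -> (0 <= extend0 f z)%E.
Proof. by case: z => /=. Qed.

Lemma measurable_extend0_X f t : 0 <= t -> measurable_fun setT f ->
  measurable_fun setT (fun w => extend0 f (X t w)).
Proof.
move=> t0 mf; apply: (measurableT_comp (measurable_extend0 mf)).
exact: measurable_X.
Qed.

(** On the event X_s = None the integrand of the Markov property is replaced by
    0: by absorption, being in E at time s + t forces being in E at time s, so
    A can be intersected with the latter event beforehand. *)
Lemma markov_presence x s t A : 0 <= s -> 0 <= t -> F s A ->
  P (Some x) (A `&` in_E (s + t)) =
    (\int[P (Some x)]_(w in A) extend0 (presence t) (X s w))%E.
Proof.
move=> s0 t0 FA; have mA := F_measurable s0 FA.
have st0 : 0 <= s + t by rewrite addr_ge0.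
have FAE : F s (A `&` in_E s).
  apply: F_setI => //; apply: markov_adapted hM _ _ s0 _.
  exact: measurable_range_Some.
transitivity (P (Some x) (A `&` in_E s `&` in_E (s + t))).
  have [N [mN N0 subN]] := absorbed_absorbing hX x.
  have mE1 : measurable (A `&` in_E s `&` in_E (s + t)).
    by apply: measurableI; [exact: F_measurable FAE|exact: measurable_in_E].
  have mE2 : measurable (A `&` in_E (s + t)).
    by apply: measurableI => //; exact: measurable_in_E.
  apply/eqP; rewrite eq_le; apply/andP; split; last first.
    by apply: le_measure; rewrite ?inE// => w [[]].
  rewrite -(measureU0 mE1 mN N0); apply: le_measure; rewrite ?inE//.
    exact: measurableU.
  move=> w [Aw [y _ Xy]]; have [Nw|Nw] := pselect (N w); [by right|left].
  split; last by exists y.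
  split=> //; case Xs : (X s w) => [z|]; first by exists z.
  exfalso; apply: Nw; apply: subN => /= /(_ s (s + t) s0).
  by rewrite lerDl => /(_ t0 Xs); rewrite -Xy.
rewrite (markov_property hM) //; last exact: measurable_range_Some.
rewrite integral_mkcondr; apply: eq_integral => w _.
rewrite patchE; case: ifPn => [|/negP]; rewrite inE.
  by case=> y _ /= <-.
by case Xs : (X s w) => [y|//]; case; exists y.
Qed.

(** Both sides are limits of [markov_presence] along the times t + 1/n: the left
    one by [presence_cvg] at time s + t, the right one by monotone
    convergence. *)
Lemma markov_survival x s t A : 0 <= s -> 0 <= t -> F s A ->
  P (Some x) (A `&` alive X (s + t)) =
    (\int[P (Some x)]_(w in A) extend0 (survival t) (X s w))%E.
Proof.
move=> s0 t0 FA; have mA := F_measurable s0 FA.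
have st0 : 0 <= s + t by rewrite addr_ge0.
have tn0 n : 0 <= t + n.+1%:R^-1 by rewrite addr_ge0.
have := presence_cvg (x := x) st0 mA.
under eq_fun do rewrite -addrA markov_presence//.
move/cvg_lim => <-//; apply/cvg_lim => //.
pose g n w := extend0 (presence (t + n.+1%:R^-1)) (X s w).
rewrite (eq_integral (fun w => limn (g^~ w))); last first.
  move=> w _; apply/esym/cvg_lim => //; rewrite /g.
  by case: (X s w) => [y|] /=; [exact: survival_cvg|exact: cvg_cst].
apply: (@cvg_monotone_convergence _ _ _ (P (Some x)) A mA g).
- move=> n; apply: measurable_funTS; apply: measurable_extend0_X => //.
  exact: measurable_presence.
- by move=> n w _; apply: extend0_ge0 => y; exact: measure_ge0.
- move=> w _ n m nm; rewrite /g; case: (X s w) => [y|] //=.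
  by apply: presence_nonincreasing; rewrite // lerD2l lef_pV2 ?posrE// ler_nat.
Qed.

(** [markov_survival] with duration 0 turns the probability of a joint event at
    time t into the integral of a fixed function against the law of X_t, which
    depends measurably on the starting point. *)
Lemma measurable_X_alive t B : 0 <= t -> measurable B ->
  measurable_fun setT (fun x => P (Some x) (X t @^-1` B `&` alive X t)).
Proof.
move=> t0 mB; have mX := measurable_X t0.
pose f := extend0 (survival 0) \_ B.
have mf : measurable_fun setT f.
  apply/(measurable_restrictT _ mB)/measurable_funTS/measurable_extend0.
  exact: measurable_survival.
have f0 z : (0 <= f z)%E.
  rewrite /f patchE; case: ifPn => // _; apply: extend0_ge0 => x.
  exact: survival_ge0.
have -> : (fun x => P (Some x) (X t @^-1` B `&` alive X t)) =
    (fun z => \int[pushforward (P z) (X t)]_y f y)%E \o Some.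
  apply/funext => x /=.
  rewrite ge0_integral_pushforward//.
  rewrite preimage_setT -[X in alive _ X]addr0 markov_survival//; last first.
    exact: markov_adapted hM _ _ t0 mB.
  rewrite [LHS]integral_mkcond; apply: eq_integral => w _.
  by rewrite /f /= !patchE.
apply: (measurableT_comp _ (@measurable_Some _ E)).
apply: measurable_fun_integral_kernel => // U mU.
exact: markov_kernel hM _ _ t0 mU.
Qed.

(** Singletons of E need not be measurable; the integral against the Dirac mass
    is evaluated thanks to [measurable_X_alive]. *)
Lemma cond_law_dirac x t B : 0 <= t -> measurable B ->
  cond_law X P (\d_x : probability E R) t B =
  fine (P (Some x) (X t @^-1` (Some @` B) `&` alive X t)) /
    fine (survival t x).
Proof.
move=> t0 mB; rewrite /cond_law /cond_prob /P_init.
rewrite !integral_dirac//.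
- by rewrite diracE in_setT !mul1e.
- exact: measurable_survival.
- exact: measurable_X_alive t0 (measurable_image_Some mB).
Qed.

Lemma measurable_odflt x : measurable_fun setT (@odflt E x).
Proof. by apply: measurable_fun_option => _ B mB; rewrite setTI. Qed.

Lemma survival_gt0 t x : 0 <= t -> 0 < fine (survival t x).
Proof.
move=> t0; rewrite fine_gt0// (absorbed_alive hX)//=.
by rewrite (le_lt_trans (survival_le1 _ t0)) ?ltry.
Qed.

Lemma alive_in_E t w : 0 <= t -> alive X t w -> in_E t w.
Proof.
move=> t0 tw; case Xt : (X t w) => [y|]; first by exists y.
suff : (tau_abs X w <= t%:E)%E by rewrite leNgt tw.
by apply: ereal_inf_lbound; exists t.
Qed.

(** After division by the survival probability at time s, this compares the
    integrals of [survival t] against the conditional law at time s and against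
    alpha. *)
Lemma cond_survival_tv (alpha : probability E R) x s t (e M : R) :
  0 <= s -> 0 <= t ->
  (tv_norm (fun B => (cond_law X P (\d_x : probability E R) s B
     - fine (alpha B))%R) <= e%:E)%E ->
  0 <= M -> (forall y, survival t y <= M%:E)%E ->
  `|fine (survival (s + t) x) - fine (survival s x)
      * fine (\int[alpha]_y survival t y)%E| <= fine (survival s x) * (M * e).
Proof.
move=> s0 t0 tv M0 hM'.
have st0 : 0 <= s + t by rewrite addr_ge0.
have mA := measurable_alive s0.
set c := fine (survival s x); have c0 : 0 < c by exact: survival_gt0.
have ci0 : 0 <= c^-1 by rewrite invr_ge0 ltW.
(* On the event alive X s the path is in E, so the default value x is not
   seen by the conditional law m. *)
pose phi w := odflt x (X s w).
have mphi : measurable_fun setT phi.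
  exact: measurableT_comp (measurable_odflt x) (measurable_X s0).
pose m0 : {measure set E -> \bar R} :=
  measure_function_pushforward__canonical__measure_function_Measure
    (mrestr (P (Some x)) mA) mphi.
pose m : {measure set E -> \bar R} := mscale (NngNum ci0) m0.
have m0E B : m0 B = P (Some x) (X s @^-1` (Some @` B) `&` alive X s).
  congr (P (Some x) _); apply/seteqP; split=> w [Bw Aw]; split=> //.
    have [y _ Xy] := alive_in_E s0 Aw.
    by exists y => //; move: Bw; rewrite /phi /= -Xy.
  by case: Bw => y By Xy; rewrite /phi /= -Xy.
have mE B : measurable B ->
    m B = (cond_law X P (\d_x : probability E R) s B)%:E.
  move=> mB; rewrite cond_law_dirac// mulrC EFinM fineK ?m0E//.
    by rewrite -m0E.
  apply: fin_num_measure; apply: measurableI => //.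
  by rewrite -[X in measurable X]setTI; apply: measurable_X => //;
    exact: measurable_image_Some.
have finm B : measurable B -> m B \is a fin_num by move=> mB; rewrite mE.
have fina B : measurable B -> alpha B \is a fin_num.
  by move=> mB; exact: fin_num_measure.
have mS := measurable_survival t0.
have intm : (\int[m]_y survival t y)%E = (c^-1 * fine (survival (s + t) x))%:E.
  rewrite ge0_integral_mscale//.
  rewrite EFinM fineK ?survival_fin_num//; congr (_ * _)%E.
  have -> : (\int[m0]_y survival t y =
      \int[mrestr (P (Some x)) mA]_w (survival t \o phi) w)%E.
    exact: ge0_integral_pushforward.
  have -> : (\int[mrestr (P (Some x)) mA]_w (survival t \o phi) w =
      \int[P (Some x)]_(w in alive X s) (survival t \o phi) w)%E.
    apply: integral_mrestr => [|w]; last exact: survival_ge0.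
    exact: measurableT_comp mS mphi.
  have := markov_survival x s0 t0 (F_alive s0).
  rewrite setIidr; last first.
    by move=> w; apply: le_lt_trans; rewrite lee_fin lerDl.
  rewrite /survival => ->; apply: eq_integral => w /[!inE] /(alive_in_E s0).
  by case=> y _ Xy; rewrite /= /phi -Xy.
have {}tv : (tv_norm (fun B => (fine (m B) - fine (alpha B))%R) <= e%:E)%E.
  rewrite (eq_tv_norm (nu2 := fun B =>
    (cond_law X P (\d_x : probability E R) s B - fine (alpha B))%R))// => B mB.
  by rewrite mE.
have tv' : (tv_norm (fun B => (fine (alpha B) - fine (m B))%R) <= e%:E)%E.
  rewrite (eq_tv_norm (nu2 := fun B =>
    (fine (m B) - fine (alpha B))%R))// => B _.
  exact: distrC.
have S0 y : (0 <= survival t y)%E by exact: survival_ge0.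
have finI : (\int[alpha]_y survival t y)%E \is a fin_num.
  rewrite ge0_fin_numE ?integral_ge0//.
  apply: (@le_lt_trans _ _ (\int[alpha]_y (cst 1%E y))%E).
    by apply: ge0_le_integral => // y _; exact: survival_le1.
  rewrite integral_cst//= mul1e.
  by rewrite (le_lt_trans (probability_le1 alpha measurableT)) ?ltry.
have := le_integral_tv finm fina tv M0 S0 hM'.
have := le_integral_tv fina finm tv' M0 S0 hM'.
rewrite intm -(fineK finI) -!EFinD !lee_fin /=.
set J := fine _; set S := fine (survival (s + t) x) => h1 h2.
have cE : c * (c^-1 * S) = S by rewrite mulrA divff ?mul1r ?gt_eqF.
have {}h1 := ler_wpM2l (ltW c0) h1; have {}h2 := ler_wpM2l (ltW c0) h2.
rewrite /= mulrDr cE in h1; rewrite cE mulrDr in h2.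
by rewrite ler_norml; apply/andP; split; lra.
Qed.

(** A pointwise relative comparison of two survival functions is inherited by
    the probabilities of surviving on an event A of the past, these being
    integrals of the survival functions with the same weight. *)
Lemma restricted_survival_compare x t s u A (k d : R) :
  0 <= t -> 0 <= s -> 0 <= u -> F t A -> 0 <= k -> 0 <= d ->
  (forall y, `|fine (survival u y) - k * fine (survival s y)|
     <= d * fine (survival s y)) ->
  `|fine (P (Some x) (A `&` alive X (t + u)))
     - k * fine (P (Some x) (A `&` alive X (t + s)))|
  <= d * fine (P (Some x) (A `&` alive X (t + s))).
Proof.
move=> t0 s0 u0 FA k0 d0 cmp.
have mA := F_measurable t0 FA.
have finP v : 0 <= v -> P (Some x) (A `&` alive X (t + v)) \is a fin_num.
  move=> v0; apply: fin_num_measure; apply: measurableI => //.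
  by apply: measurable_alive; rewrite addr_ge0.
pose f v w := extend0 (survival v) (X t w).
have mf v : 0 <= v -> measurable_fun A (f v).
  move=> v0; apply: measurable_funTS; apply: measurable_extend0_X => //.
  exact: measurable_survival.
have f0 v w : (0 <= f v w)%E.
  by apply: extend0_ge0 => y; exact: survival_ge0.
have intf v : 0 <= v -> (\int[P (Some x)]_(w in A) f v w)%E =
    (fine (P (Some x) (A `&` alive X (t + v))))%:E.
  by move=> v0; rewrite fineK ?finP// markov_survival.
have cf0 (c : R) w : 0 <= c -> (0 <= c%:E * f s w)%E.
  by move=> c0; rewrite mule_ge0.
have mcf (c : R) : measurable_fun A (fun w => c%:E * f s w)%E.
  by apply: measurable_funeM; exact: mf.
have intcf (c : R) : 0 <= c ->
    (\int[P (Some x)]_(w in A) (c%:E * f s w))%E =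
    (c * fine (P (Some x) (A `&` alive X (t + s))))%:E.
  by move=> c0; rewrite ge0_integralZl_EFin// ?intf//; exact: mf.
have fE v w : 0 <= v -> f v w = (fine (f v w))%:E.
  move=> v0; rewrite /f; case: (X t w) => [y|]//=.
  by rewrite fineK ?survival_fin_num.
have cmpf w : `|fine (f u w) - k * fine (f s w)| <= d * fine (f s w).
  by rewrite /f; case: (X t w) => [y|] //=; rewrite !mulr0 subr0 normr0.
set a := fine _; set b := fine _.
have le1 : a <= (k + d) * b.
  rewrite -lee_fin -intf// -intcf ?addr_ge0//; apply: ge0_le_integral => //.
  - exact: mf.
  - move=> w _; rewrite (fE u)// (fE s)// -EFinM lee_fin.
    by have := cmpf w; rewrite ler_norml => /andP[_]; lra.
have le2 : k * b <= a + d * b.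
  rewrite -lee_fin EFinD -intf// -!intcf// -ge0_integralD//; last 2 first.
  - exact: mf.
  - by move=> w _; exact: cf0.
  apply: ge0_le_integral => //.
  - by move=> w _; exact: cf0.
  - by apply: emeasurable_funD => //; exact: mf.
  - move=> w _; rewrite (fE u)// (fE s)// -!EFinM -EFinD lee_fin.
    by have := cmpf w; rewrite ler_norml => /andP[+ _]; lra.
by rewrite ler_norml; apply/andP; split; lra.
Qed.

End absorbed_process_survival.

(** * Uniform limits and ratios *)

Section uniform_limit.
Set Implicit Arguments.
Unset Strict Implicit.
Unset Printing Implicit Defensive.
Context (R : realType) (T : Type) (f : R -> T -> R) (g : T -> R).

Lemma sup_dist_cvg0_lt (e : R) :
  ereal_sup (range (fun x => `|f t x - g x|%:E)) @[t --> +oo] --> 0%E ->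
  0 < e -> exists2 t0, 0 <= t0 & forall t x, t0 <= t -> `|f t x - g x| < e.
Proof.
move=> fg e0.
have /fg : nbhs 0%E [set y : \bar R | (y < e%:E)%E].
  apply: open_nbhs_nbhs; split; first exact: open_ereal_lt_ereal.
  by rewrite /= lte_fin.
move=> [a [_ fa]]; exists (Num.max 0 (a + 1)); first by rewrite le_max lexx.
move=> t x; rewrite ge_max => /andP[_ at1].
rewrite -lte_fin; apply: le_lt_trans (fa t _); last first.
  by rewrite (lt_le_trans _ at1)// ltrDl.
by apply: ereal_sup_ubound; exists x.
Qed.

End uniform_limit.

(** The identity
    n'/s' - n/s = ((n' - n) - (n'/s') (s' - s)) / s
    only involves differences that are controlled, and n'/s' <= 1. *)
Lemma ratio_distance (R : realFieldType) (n n' s s' d : R) :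
  0 < s -> 0 < s' -> 0 <= n <= s -> 0 <= n' <= s' ->
  `|n' - n| <= d * n -> `|s' - s| <= d * s -> 0 <= d ->
  `|n' / s' - n / s| <= 2 * d.
Proof.
move=> s0 s'0 /andP[n0 ns] /andP[n'0 n's'] hn hs d0.
have -> : n' / s' - n / s = ((n' - n) - n' / s' * (s' - s)) / s.
  by field; rewrite !gt_eqF.
have q1 : `|n' / s'| <= 1.
  by rewrite ger0_norm ?divr_ge0 ?(ltW s'0)// ler_pdivrMr// mul1r.
rewrite normrM normfV (gtr0_norm s0) ler_pdivrMr//.
apply: le_trans (ler_normB _ _) _.
rewrite normrM mulrDl mul1r mulrDl lerD//.
  by apply: le_trans hn _; rewrite ler_wpM2l.
by rewrite -[leRHS]mul1r ler_pM.
Qed.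

(** * Exponential convergence to the Q-process *)

Theorem theorem2p1 (R : realType) (dO dE : measure_display)
  (Omega : measurableType dO) (E : measurableType dE)
  (F : R -> set (set Omega)) (X : R -> Omega -> option E)
  (P : option E -> probability Omega R)
  (hX : absorbed_markov_process F X P)
  (alpha : probability E R) (C gamma : R) (hC : 0 < C) (hgamma : 0 < gamma)
  (hconv : forall (mu : probability E R) (t : R), 0 <= t ->
    (tv_norm (fun B : set E => (cond_law X P mu t B - fine (alpha B))%R)
      <= (C * expR (- (gamma * t)))%:E)%E)
  (lambda0 : R) (hlambda0 : 0 < lambda0)
  (hdecay : forall t : R, 0 <= t ->
    P_init P alpha (alive X t) = (expR (- (lambda0 * t)))%:E)
  (eta : E -> R) (heta_gt0 : forall x : E, 0 < eta x)
  (heta_int : (\int[alpha]_x (eta x)%:E)%E = 1%E)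
  (heta_lim : ereal_sup (range (fun x : E =>
      `|expR (lambda0 * t) * fine (P (Some x) (alive X t)) - eta x|%:E))
    @[t --> +oo] --> 0%E)
  (Q : E -> probability (g_sigma_algebraType (F_infty F)) R)
  (hQ : is_Q_process X P Q) :
  (exists2 a1 : R, 0 < a1 & forall (x : E) (t : R), 0 <= t ->
    `|expR (lambda0 * t) * fine (P (Some x) (alive X t)) - eta x|
      <= a1 * expR (lambda0 * t) * fine (P (Some x) (alive X t))
           * expR (- (gamma * t)))
  /\
  (exists2 a2 : R, 0 < a2 & forall (x : E) (t T : R) (A : set Omega),
    0 <= t -> F t A -> t <= T ->
    `|fine (Q x A) - cond_prob (P (Some x)) A (alive X T)|
      <= a2 * expR (- (gamma * (T - t)))).
Proof.
have [t0 t00 eta1] := sup_dist_cvg0_lt heta_lim ltr01.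
pose S t x := fine (survival X P t x).
have S_ge0 t x : 0 <= S t x by rewrite fine_ge0// survival_ge0.
have S_gt0 t x : 0 <= t -> 0 < S t x by exact: (survival_gt0 hX).
have S_le1 t x : 0 <= t -> S t x <= 1.
  move=> t_ge0; rewrite -lee_fin fineK; first exact: (survival_le1 hX).
  exact: (survival_fin_num hX).
(* For t >= t0, exp(lambda0 t) S_t is within 1 of eta, itself within 1 of
   exp(lambda0 t0) S_t0; this is where the 2 comes from. *)
pose M : R := expR (lambda0 * t0) + 2.
have M0 : 0 < M by rewrite addr_gt0 ?expR_gt0.
have MS t x : 0 <= t -> expR (lambda0 * t) * S t x <= M.
  move=> t_ge0; have expS u : 0 <= u -> u <= t0 ->
      expR (lambda0 * u) * S u x <= expR (lambda0 * t0).
    move=> u0 ut0; rewrite -[leRHS]mulr1 ler_pM ?expR_ge0 ?S_le1//.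
    by rewrite ler_expR ler_pM2l.
  have [tt0|/ltW t0t] := leP t t0.
    by apply: le_trans (expS _ t_ge0 tt0) _; rewrite lerDl.
  have := eta1 t x t0t; have := eta1 t0 x (lexx _); have := expS _ t00 (lexx _).
  rewrite -/(S t x) -/(S t0 x) !ltr_norml => + /andP[+ _] /andP[_].
  rewrite /M; lra.
have MS' t x : 0 <= t ->
    (survival X P t x <= (M * expR (- (lambda0 * t)))%:E)%E.
  move=> t_ge0; rewrite -[survival _ _ _ _]fineK ?(survival_fin_num hX)//.
  by rewrite lee_fin expRN ler_pdivlMr ?expR_gt0// mulrC MS.
pose a := M * C; have a0 : 0 < a by rewrite mulr_gt0.
pose D s := a * expR (- (gamma * s)).
have D0 s : 0 <= D s by rewrite mulr_ge0 ?expR_ge0// ltW.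
have expK r : expR (lambda0 * r) * expR (- (lambda0 * r)) = 1.
  by rewrite expRN divff// gt_eqF ?expR_gt0.
(* S_r is bounded by M exp(- lambda0 r) and alpha integrates it to
   exp(- lambda0 r): this common factor is what makes D s independent of r. *)
have core s r y : 0 <= s -> 0 <= r ->
    `|S (s + r) y - expR (- (lambda0 * r)) * S s y|
      <= expR (- (lambda0 * r)) * D s * S s y.
  move=> s0 r0.
  have Mr0 : 0 <= M * expR (- (lambda0 * r)).
    by rewrite mulr_ge0 ?expR_ge0// ltW.
  have := cond_survival_tv hX (x := y) s0 r0 (hconv _ _ s0) Mr0
    (fun z => MS' r z r0).
  have -> : (\int[alpha]_z survival X P r z)%E = (expR (- (lambda0 * r)))%:E.
    exact: hdecay.
  rewrite /= -/(S (s + r) y) -/(S s y) (mulrC _ (expR _)); congr (_ <= _).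
  by rewrite /D /a; ring.
have compare x t s r A : 0 <= t -> 0 <= s -> 0 <= r -> F t A ->
    `|expR (lambda0 * r) * fine (P (Some x) (A `&` alive X (t + (s + r))))
      - fine (P (Some x) (A `&` alive X (t + s)))|
    <= D s * fine (P (Some x) (A `&` alive X (t + s))).
  move=> t_ge0 s0 r0 FA.
  have := restricted_survival_compare hX x t_ge0 s0 (addr_ge0 s0 r0) FA
    (expR_ge0 (- (lambda0 * r))) (mulr_ge0 (expR_ge0 (- (lambda0 * r))) (D0 s))
    (fun y => core s r y s0 r0).
  rewrite -(ler_pM2l (expR_gt0 (lambda0 * r))).
  rewrite -{1}[expR _]gtr0_norm ?expR_gt0// -normrM mulrBr !mulrA expK !mul1r.
  by [].
split.
- exists a => // x t t_ge0.
  rewrite -/(survival X P t x) -/(S t x) distrC.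
  apply/ler_addgt0Pr => e e0.
  have [t1 t1_ge0 eta_e] := sup_dist_cvg0_lt heta_lim e0.
  have t1t : t1 <= t + t1 by rewrite lerDr.
  have {eta_e} := eta_e _ x t1t.
  have := compare x 0 t t1 setT (lexx _) t_ge0 t1_ge0 (F_setT hX (lexx _)).
  rewrite !setTI !add0r -/(survival X P _ x) -/(survival X P t x).
  rewrite -/(S t x) -/(S (t + t1) x) mulrDr expRD => h1 h2.
  have := ler_wpM2l (expR_ge0 (lambda0 * t)) h1.
  rewrite -{1}[expR (lambda0 * t)]gtr0_norm ?expR_gt0// -normrM mulrBr mulrA.
  set p := _ * _ * S _ _ in h2 *; set q := expR _ * S t x => {}h1.
  rewrite (_ : eta x - q = (p - q) - (p - eta x)); last by ring.
  apply: le_trans (ler_normB _ _) _; apply: lerD _ (ltW h2).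
  apply: le_trans h1 _; rewrite /q /D le_eqVlt.
  by apply/orP; left; apply/eqP; ring.
- exists (2 * a); first by rewrite mulr_gt0.
  move=> x t T A t_ge0 FA tT.
  have s0 : 0 <= T - t by rewrite subr_ge0.
  have T0 : 0 <= T := le_trans t_ge0 tT.
  have mA := F_measurable hX t_ge0 FA.
  set N := fun u => fine (P (Some x) (A `&` alive X u)).
  have NS u : 0 <= u -> 0 <= N u <= S u x.
    move=> u0; have mu := measurable_alive hX u0.
    have mAu : measurable (A `&` alive X u) by exact: measurableI.
    rewrite fine_ge0//= fine_le//; first exact: fin_num_measure.
      exact: (survival_fin_num hX).
    by apply: le_measure; rewrite ?inE.
  (* Multiplying numerator and denominator by exp(lambda0 r) makes both of
     them close to their values at r = 0. *)
  have cond_dist r : 0 <= r -> `|N (T + r) / S (T + r) x - N T / S T x|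
      <= 2 * D (T - t).
    move=> r0; have Tr0 : 0 <= T + r by rewrite addr_ge0.
    have := compare x 0 T r setT (lexx _) T0 r0 (F_setT hX (lexx _)).
    rewrite !setTI !add0r => hS.
    have := compare x t (T - t) r A t_ge0 s0 r0 FA.
    rewrite (_ : t + (T - t + r) = T + r); last by ring.
    rewrite (_ : t + (T - t) = T); last by ring.
    move=> hN.
    have g0 : 0 < expR (lambda0 * r) by exact: expR_gt0.
    have -> : N (T + r) / S (T + r) x =
        (expR (lambda0 * r) * N (T + r)) / (expR (lambda0 * r) * S (T + r) x).
      by rewrite -mulf_div divff ?mul1r// gt_eqF.
    have /andP[N'0 N'S'] := NS _ Tr0.
    apply: ratio_distance hN _ (D0 _); rewrite ?mulr_gt0 ?S_gt0 ?NS//.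
      by rewrite mulr_ge0 ?(ltW g0)//= ler_pM2l.
    apply: le_trans hS _; apply: ler_wpM2r; first exact: S_ge0.
    apply: ler_wpM2l; first exact: ltW.
    by rewrite ler_expR lerN2 ler_pM2l// gerBl.
  apply/ler_addgt0Pr => e e0.
  have /cvgrPdist_lt /(_ e e0) [b [_ hb]] := hQ x t A t_ge0 FA.
  pose u := Num.max T (b + 1).
  have Tu : T <= u by rewrite le_max lexx.
  have /hb /= Qu : b < u by rewrite lt_max ltrDl ltr01 orbT.
  have uT0 : 0 <= u - T by rewrite subr_ge0.
  have := cond_dist _ uT0; rewrite (addrC T) subrK => hu.
  rewrite -mulrA -/(D _) [leRHS]addrC.
  apply: le_trans (ler_distD (cond_prob (P (Some x)) A (alive X u)) _ _) _.
  exact: lerD (ltW Qu) hu.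
Qed.
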